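(* Let $X$ be a Tychonoff space. If any of the spaces $(MC(X),\tau_V^+)$, $(L_0(X),\tau_V^+)$, $(L(X),\tau_V^+)$, $(MC(X),\tau_V)$, $(L_0(X),\tau_V)$ or $(L(X),\tau_V)$ is first countable, then $X$ is countably compact.
   Context: All topological spaces are assumed Hausdorff and non-empty. A set-valued map $F$ from $X$ to $\mathbb{R}$ is identified with its graph $F\subseteq X\times\mathbb{R}$, with $F(x)=\{y:(x,y)\in F\}$. $F$ is usc if for every $x\in X$ and every open $V\supseteq F(x)$ there is a neighborhood $U$ of $x$ with $F(x')\subseteq V$ for all $x'\in U$. $F$ is cusco if it is usc and $F(x)$ is non-empty, compact and convex for every $x\in X$; it is minimal cusco if it is cusco and every cusco map $G\subseteq F$ satisfies $G=F$. $L(X)$ is the set of all cusco maps $F\subseteq X\times\mathbb{R}$; $L_0(X)$ is the set of $F\in L(X)$ such that $F(x)$ is a singleton for every isolated point $x$ of $X$; $MC(X)$ is the set of minimal cusco maps $F\subseteq X\times\mathbb{R}$. All are subsets of $CL(X\times\mathbb{R})$, the set of non-empty closed subsets of $X\times\mathbb{R}$. For $W$ open in $X\times\mathbb{R}$ let $W^+=\{A:A\subseteq W\}$ and $W^-=\{A:A\cap W\neq\emptyset\}$. The Vietoris topology $\tau_V$ is generated by the subbase of all $W^+$ and all $W^-$; the upper Vietoris topology $\tau_V^+$ has as base all $W^+$; subsets of $CL(X\times\mathbb{R})$ carry the subspace topologies, denoted by the same symbols. *)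

(* Defs.v *)
From HB Require Import structures.
From mathcomp Require Import all_boot all_order all_algebra.
From mathcomp Require Import all_classical all_reals all_analysis.

Set Implicit Arguments.
Unset Strict Implicit.
Unset Printing Implicit Defensive.

Import Order.TTheory GRing.Theory Num.Theory.
Import numFieldNormedType.Exports.
Local Open Scope classical_set_scope.
Local Open Scope ring_scope.

Definition tychonoff_space (T : topologicalType) :=
  hausdorff_space T /\ completely_regular_space T.

Definition first_countable (T : topologicalType) :=
  forall x : T, exists2 B : set_system T, countable B &
    B `<=` nbhs x /\ forall V, nbhs x V -> exists2 U, B U & U `<=` V.

Definition countably_compact (T : topologicalType) (A : set T) :=
  forall (I : choiceType) (D : set I) (f : I -> set T), countable D ->
    (forall i, D i -> open (f i)) -> A `<=` cover D f ->
    finite_subset_cover D f A.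

(* The hyperspace CL(Y); it carries no topology of its own, the two topologies
   live on the aliases [vietoris Y] and [upper_vietoris Y]. *)
Definition CL (Y : topologicalType) : Type :=
  set_type [set A : set Y | closed A /\ A !=set0].

HB.instance Definition _ (Y : topologicalType) := Choice.on (CL Y).

Definition CL_set (Y : topologicalType) (A : CL Y) : set Y := set_val A.

Definition plus_set (Y : topologicalType) (W : set Y) : set (CL Y) :=
  [set A | CL_set A `<=` W].

Definition minus_set (Y : topologicalType) (W : set Y) : set (CL Y) :=
  [set A | CL_set A `&` W !=set0].

Definition vietoris (Y : topologicalType) : Type := CL Y.
Definition upper_vietoris (Y : topologicalType) : Type := CL Y.

HB.instance Definition _ (Y : topologicalType) := Choice.on (vietoris Y).
HB.instance Definition _ (Y : topologicalType) := Choice.on (upper_vietoris Y).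

Definition vietoris_subbase (Y : topologicalType) : set_system (CL Y) :=
  [set plus_set W | W in open] `|` [set minus_set W | W in open].

HB.instance Definition _ (Y : topologicalType) :=
  isSubBaseTopological.Build (vietoris Y) (@vietoris_subbase Y) id.

Lemma upper_vietoris_cover (Y : topologicalType) :
  \bigcup_(W in open) @plus_set Y W = setT.
Proof.
by apply/seteqP; split=> // A _; exists setT => //; exact: openT.
Qed.

Lemma upper_vietoris_join (Y : topologicalType) (V W : set Y) (A : CL Y) :
  open V -> open W -> plus_set V A -> plus_set W A ->
  exists U,
    [/\ open U, plus_set U A & plus_set U `<=` plus_set V `&` plus_set W].
Proof.
move=> oV oW AV AW; exists (V `&` W); split; first exact: openI.
  by rewrite /plus_set /= subsetI.
by move=> B; rewrite /plus_set /= subsetI.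
Qed.

HB.instance Definition _ (Y : topologicalType) :=
  isBaseTopological.Build (upper_vietoris Y)
    (@upper_vietoris_cover Y) (@upper_vietoris_join Y).

Definition vietoris_subspace (Y : topologicalType) (S : set (CL Y)) :
  topologicalType := set_type (S : set (vietoris Y)).

Definition upper_vietoris_subspace (Y : topologicalType) (S : set (CL Y)) :
  topologicalType := set_type (S : set (upper_vietoris Y)).

Section set_valued_maps.
Context {X : topologicalType} {R : realType}.

(* A set-valued map is its graph, with value [xsection F x] at x. *)
Implicit Types F G : set (X * R).

Definition usc F :=
  forall (x : X) (V : set R), open V -> xsection F x `<=` V ->
    exists2 U, nbhs x U & forall x', U x' -> xsection F x' `<=` V.

Definition cusco F :=
  usc F /\ forall x, [/\ xsection F x !=set0, compact (xsection F x) &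
                         convex_set (xsection F x : set R^o)].

Definition minimal_cusco F :=
  cusco F /\ forall G, cusco G -> G `<=` F -> G = F.

Lemma cusco_neq0 F : [set: X] !=set0 -> cusco F -> F !=set0.
Proof. by move=> [x _] [_ /(_ x)[[y /xsectionP Fxy] _ _]]; exists (x, y). Qed.

(* Closedness of the graph is automatic, so cutting the spaces below out of
   [CL (X * R)] loses no cusco map. *)
Lemma cusco_closed F : cusco F -> closed F.
Proof.
move=> [uscF cF]; rewrite -[F]setCK; apply: open_closedC.
rewrite openE => -[x y] /= nFxy.
have [_ /(compact_closed (@Rhausdorff R)) cFx _] := cF x.
have : nbhs y (~` xsection F x).
  by apply: open_nbhs_nbhs; split; [rewrite openC|move/xsectionP].
move=> /nbhs_closedballP[e yeF].
have [|z Fz yz|U xU UF] := uscF x (~` closed_ball y e%:num).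
- by rewrite openC; exact: closed_ball_closed.
- exact: yeF yz Fz.
exists (U, ball y e%:num) => /=.
  by split=> //; apply: nbhsx_ballx.
move=> [x' y'] /= [Ux' yy'] Fxy'; apply: (UF x' Ux' y').
  exact/xsectionP.
by apply: subset_closed_ball.
Qed.

End set_valued_maps.

Definition cusco_maps (X : topologicalType) (R : realType) :
  set (CL (X * R)%type) := [set F | cusco (CL_set F)].

Definition cusco_maps0 (X : topologicalType) (R : realType) :
  set (CL (X * R)%type) :=
  [set F | cusco (CL_set F) /\
    forall x, isolated [set: X] x -> exists y, xsection (CL_set F) x = [set y]].

Definition minimal_cusco_maps (X : topologicalType) (R : realType) :
  set (CL (X * R)%type) := [set F | minimal_cusco (CL_set F)].

Arguments cusco_maps : clear implicits.
Arguments cusco_maps0 : clear implicits.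
Arguments minimal_cusco_maps : clear implicits.

(* Main.v *)
Require Import Defs.
From mathcomp Require Import all_boot all_order all_algebra.
From mathcomp Require Import all_classical all_reals all_analysis.

Set Implicit Arguments.
Unset Strict Implicit.
Unset Printing Implicit Defensive.

Import Order.TTheory GRing.Theory Num.Theory.
Import numFieldNormedType.Exports.
Local Open Scope classical_set_scope.
Local Open Scope ring_scope.

(** All six spaces contain the graph of every continuous real function on X,
    and the argument uses nothing else about them.  Suppose that the graph F0
    of the zero function has a countable base of neighborhoods N n, and that a
    sequence s of points of X has no cluster point.

    A Vietoris neighborhood of F0 cannot exclude small bumps: for each point x
    it contains the graphs of all continuous g with 0 <= g <= d that vanish off
    some neighborhood U of x, provided that U and d > 0 are small enough.  The
    conditions of the form A `<=` W are met because W contains a rectangle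
    around (x, 0); those of the form A `&` W !=set0 are met at any point of F0
    in W because g is uniformly small ([vietoris_small_bumps]).  Complete
    regularity provides such a g with g x = d ([completely_regular_bump]).
    Hence every N n contains a graph through some point (s n, e n) with
    e n != 0.

    Since s has no cluster point in X, the points (s n, e n) have none in
    X * R, so they form a closed set, which misses F0.  Its complement W gives
    a neighborhood of F0, the set of all A included in W, and no N n lies in
    it: this contradicts the choice of the N n ([first_countable_graphs]).  So
    every sequence of X has a cluster point, and X is countably compact
    ([cluster_seq_countably_compact]).

    The neighborhood coming from W is open for the upper topology, and upper
    neighborhoods are Vietoris neighborhoods; hence the same argument serves
    both topologies. *)

(** * Sequences without cluster points *)

(** If a countable cover has no finite subcover, choose s m outside the union
    V m of the members whose index has code below m: a member of code k then
    contains s m only for m <= k, so no point of it is a cluster point. *)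
Lemma cluster_seq_countably_compact (X : topologicalType) :
  (forall s : nat -> X, cluster (s @ \oo) !=set0) -> countably_compact [set: X].
Proof.
move=> clX I D f /countable_injP[h h_inj] f_open f_cover.
apply: contrapT => no_subcover.
pose V m := \bigcup_(i in [set i | D i /\ (h i < m)%N]) f i.
have V_fin m : finite_set [set i | D i /\ (h i < m)%N].
  rewrite (eq_finite_set (card_esym (inj_card_eq (f := h) _))).
    by apply: sub_finite_set (finite_II m) => _ [i [_ him] <-].
  by move=> i j; rewrite !inE => -[Di _] [Dj _]; apply: h_inj; rewrite inE.
have /choice[s sV] m : exists x, ~ V m x.
  apply/existsNP => Vm; apply: no_subcover.
  exists (fset_set [set i | D i /\ (h i < m)%N]).
    by move=> i; rewrite in_fset_set// !inE => -[].
  move=> x _; have [i Di fix_] := Vm x; exists i => //=.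
  by rewrite in_fset_set// inE.
have [x x_cluster] := clX s.
have [i Di fix_] := f_cover x Logic.I.
have [||y [[k /= hik <-] fisk]] :=
  x_cluster (s @` [set k | (h i < k)%N]) (f i).
- by exists (h i).+1 => // k hik; exists k.
- by apply: open_nbhs_nbhs; split=> //; exact: f_open.
- by apply: (sV k); exists i.
Qed.

(** A point off the range has a neighborhood meeting only finitely many terms,
    and finite sets are closed. *)
Lemma closed_range_seq (Y : topologicalType) (t : nat -> Y) :
  hausdorff_space Y -> cluster (t @ \oo) = set0 -> closed (range t).
Proof.
move=> hY no_cluster; rewrite -[range t]setCK; apply: open_closedC.
rewrite openE => y nty.
have : ~ cluster (t @ \oo) y by rewrite no_cluster.
move=> /existsNP[A /existsNP[B /not_implyP[[m _ mA] /not_implyP[yB AB0]]]].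
have fin_closed : closed (t @` `I_m).
  move/hausdorff_accessible/accessible_finite_set_closed : hY; apply.
  exact: finite_image.
have : nbhs y (B `&` ~` (t @` `I_m)).
  apply: filterI => //; apply: open_nbhs_nbhs; split.
    exact: closed_openC.
  by move=> [k _ tky]; apply: nty; exists k.
apply: filterS => z [Bz ntz] [k _ tkz].
case: (ltnP k m) => km; first by apply: ntz; exists k.
by apply: AB0; exists z; split => //; rewrite -tkz; exact: mA.
Qed.

Lemma hausdorff_prod (X Y : topologicalType) :
  hausdorff_space X -> hausdorff_space Y -> hausdorff_space (X * Y)%type.
Proof.
move=> hX hY p q pq; apply: injective_projections.
  apply: hX => A B pA qB.
  have [||r [Ar Br]] := pq (fst @^-1` A) (fst @^-1` B).
  - exact: cvg_fst.
  - exact: cvg_fst.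
  - by exists r.1.
apply: hY => A B pA qB.
have [||r [Ar Br]] := pq (snd @^-1` A) (snd @^-1` B).
- exact: cvg_snd.
- exact: cvg_snd.
- by exists r.2.
Qed.

Lemma first_countable_sequence (T : topologicalType) (x : T) :
  first_countable T -> exists2 N : nat -> set T,
    forall n, nbhs x (N n) & forall V, nbhs x V -> exists n, N n `<=` V.
Proof.
move=> /(_ x)[B /countable_injP[h h_inj] [Bx Bbase]].
(* The intersection of the members of B of code n: at most one of them, and
   the whole space if there is none. *)
exists (fun n => [set y | forall U, B U -> h U = n -> U y]) => [n|V /Bbase].
  have [[U [BU hUn]]|noU] := pselect (exists U, B U /\ h U = n).
    apply: filterS (Bx _ BU) => y Uy U' BU' hU'n.
    by have -> // : U' = U; apply: h_inj; rewrite ?inE// hUn.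
  by apply: filterE => y U BU hUn; case: noU; exists U.
by move=> [U BU UV]; exists (h U) => y /(_ U BU erefl)/UV.
Qed.

(** * Diagonal argument *)

(** The diagonal argument, for any topology on a family of subsets c F of X * R
    that contains the graph of zero: [upper] makes the sets of all F with
    c F included in W neighborhoods, and [bump] prevents any neighborhood from
    forcing c F to vanish at a given point. *)
Lemma first_countable_graphs (R : realType) (X T : topologicalType)
    (c : T -> set (X * R)) (F0 : T) :
  hausdorff_space X ->
  (forall p, c F0 p <-> p.2 = 0) ->
  (forall W, open W -> c F0 `<=` W -> nbhs F0 [set F | c F `<=` W]) ->
  (forall N x, nbhs F0 N -> exists F e, [/\ N F, e != 0 & c F (x, e)]) ->
  first_countable T -> countably_compact [set: X].
Proof.
move=> hX F0E upper bump /(first_countable_sequence F0)[N F0N N_base].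
apply: cluster_seq_countably_compact => s.
apply/set0P/eqP => s_no_cluster.
have /choice[e eP] n : exists e, e != 0 /\ exists2 F, N n F & c F (s n, e).
  have [F [e [NF e0 Fe]]] := bump _ (s n) (F0N n).
  by exists e; split=> //; exists F.
pose t n : X * R := (s n, e n).
have t_closed : closed (range t).
  apply: closed_range_seq; first exact: hausdorff_prod (@Rhausdorff R).
  rewrite -subset0 => p p_cluster.
  suff : cluster (s @ \oo) p.1 by rewrite s_no_cluster.
  move=> A B sA pB.
  have [||q [Aq Bq]] := p_cluster (fst @^-1` A) (fst @^-1` B).
  - exact: sA.
  - exact: cvg_fst.
  - by exists q.1.
have /N_base[n NnW] : nbhs F0 [set F | c F `<=` ~` range t].
  apply: upper; first exact: closed_openC.
  move=> p /F0E p0 [n _ tnp]; have [/eqP + _] := eP n; apply.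
  by rewrite -p0 -tnp.
have [_ [F /NnW FW Fe]] := eP n.
by apply: (FW _ Fe); exists n.
Qed.

(** * Graphs of continuous functions *)

Definition fgraph_set (X Y : Type) (f : X -> Y) : set (X * Y) :=
  [set p | f p.1 = p.2].

Lemma xsection_fgraph (X Y : Type) (f : X -> Y) x :
  xsection (fgraph_set f) x = [set f x].
Proof. by apply/seteqP; split=> y; rewrite /xsection/= inE /fgraph_set/=. Qed.

Lemma cusco_fgraph (R : realType) (X : topologicalType) (f : X -> R) :
  continuous f -> cusco (fgraph_set f).
Proof.
move=> cf; split=> [x V V_open|x]; rewrite xsection_fgraph.
  move=> fxV; exists (f @^-1` V).
    by apply: cf; apply: open_nbhs_nbhs; split=> //; exact: fxV.
  by move=> x' Vfx'; rewrite xsection_fgraph => _ ->.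
split; [by exists (f x)|exact: compact_set1|].
by move=> a b l; rewrite !inE => -> ->; rewrite convmm.
Qed.

(** A cusco submap takes non-empty values inside singletons. *)
Lemma minimal_cusco_fgraph (R : realType) (X : topologicalType) (f : X -> R) :
  continuous f -> minimal_cusco (fgraph_set f).
Proof.
move=> cf; split=> [|G [_ G_cusco] Gf]; first exact: cusco_fgraph.
apply/seteqP; split=> // -[x y] fxy.
have [[z /xsectionP Gxz] _ _] := G_cusco x.
by rewrite -(_ : z = y)// -[y]fxy -[z](Gf _ Gxz).
Qed.

Definition contains_graphs (R : realType) (X : topologicalType)
    (S : set (CL (X * R)%type)) :=
  forall f : X -> R, continuous f -> exists2 F, S F & CL_set F = fgraph_set f.

(** * Neighborhoods in the hyperspaces *)

Lemma upper_vietoris_nbhs (Y : topologicalType) (F : upper_vietoris Y)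
    (N : set (CL Y)) :
  nbhs F N -> exists2 W, open W & plus_set W F /\ plus_set W `<=` N.
Proof.
move=> [B [[D DW <-] [W DWW WF] BN]].
exists W; first exact: DW.
by split=> // G GW; apply: BN; exists W.
Qed.

Lemma nbhs_upper_vietoris (Y : topologicalType) (F : upper_vietoris Y) W :
  open W -> plus_set W F -> nbhs F (plus_set W).
Proof.
move=> oW FW; apply: open_nbhs_nbhs; split=> //.
by exists [set W]; [move=> _ ->|rewrite bigcup_set1].
Qed.

Lemma nbhs_vietoris (Y : topologicalType) (F : vietoris Y) W :
  open W -> plus_set W F -> nbhs F (plus_set W).
Proof.
move=> oW FW; apply: open_nbhs_nbhs; split=> //.
exists [set plus_set W]; last by rewrite bigcup_set1.
by move=> _ ->; apply: (@finI_from1 _ _ _ id); left; exists W.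
Qed.


Lemma fgraph_CL (R : realType) (X : topologicalType) (f : X -> R) :
  [set: X] !=set0 -> continuous f ->
  exists F : CL (X * R)%type, CL_set F = fgraph_set f.
Proof.
move=> X0 /cusco_fgraph f_cusco.
have fP : [set A : set (X * R) | closed A /\ A !=set0] (fgraph_set f).
  by split; [exact: cusco_closed|exact: cusco_neq0].
by exists (SigSub (mem_set fP)); rewrite /CL_set set_valE.
Qed.

(** * Small bumps around the graph of zero *)

Definition small_bump (R : realType) (X : topologicalType) (U : set X) (d : R)
    (g : X -> R) :=
  (forall x, 0 <= g x <= d) /\ (forall x, ~ U x -> g x = 0).

(** The neighborhoods of the graph of zero are compared with this filter, as
    being a filter settles the finite intersections of subbasic sets. *)
Definition small_bumps (R : realType) (X : topologicalType) (x : X) :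
    set_system (CL (X * R)%type) :=
  filter_from [set Ud : set X * R | nbhs x Ud.1 /\ 0 < Ud.2]
    (fun Ud => [set F | exists2 g, small_bump Ud.1 Ud.2 g &
                  CL_set F = fgraph_set g]).

Lemma small_bumps_filter (R : realType) (X : topologicalType) (x : X) :
  Filter (@small_bumps R X x).
Proof.
apply: filter_from_filter.
  by exists (setT, 1) => /=; split; [exact: filterT|exact: ltr01].
move=> [U d] [U' d'] /= [xU d0] [xU' d'0].
exists (U `&` U', Num.min d d') => /=.
  by split; [exact: filterI|rewrite lt_min d0].
move=> F [g [g_bd g_0] Fg]; split; exists g => //=; split=> z.
- by have := g_bd z; rewrite le_min => /and3P[-> ->].
- by move=> nU; apply: g_0 => -[].
- by have := g_bd z; rewrite le_min => /and3P[-> _ ->].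
- by move=> nU; apply: g_0 => -[].
Qed.

Lemma nbhs_zero_rect (R : realType) (X : topologicalType) (W : set (X * R)) x :
  open W -> W (x, 0) -> exists2 U, nbhs x U & exists2 d : R, 0 < d &
    forall x' y, U x' -> 0 <= y <= d -> W (x', y).
Proof.
move=> W_open Wx0.
have [[U V] /= [xU /nbhs_ballP[e /= e0 eV]] UVW] :
  nbhs (x, 0 : R) W by apply: open_nbhs_nbhs.
exists U => //; exists (e / 2); first by rewrite divr_gt0.
move=> x' y Ux' /andP[y0 yd]; apply: UVW; split=> //=; apply: eV.
by rewrite /ball/= sub0r normrN ger0_norm// (le_lt_trans yd)// gtr_pMr//
  invf_lt1// ltr1n.
Qed.

(** A subbasic set of the first kind constrains g near x only, since g vanishes
    elsewhere.  For one of the second kind, the graph of zero meets the open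
    set at some (z, 0), with z unrelated to x; the bound d alone, with no
    restriction on the support, keeps (z, g z) in it. *)
Lemma vietoris_small_bumps (R : realType) (X : topologicalType)
    (F0 : vietoris (X * R)%type) (N : set (CL (X * R)%type)) (x : X) :
  CL_set F0 = fgraph_set (fun=> 0) -> nbhs F0 N -> small_bumps x N.
Proof.
move=> F0E [_ [[D D_basic <-] [V DV VF0] DN]].
have sb_filter := small_bumps_filter R x.
have F0P z y : CL_set F0 (z, y) <-> y = 0 by rewrite F0E; split=> /esym.
suff : small_bumps x V by apply: filterS => F VF; apply: DN; exists V.
have [D' D'_sub V_cap] := D_basic V DV.
rewrite -V_cap in VF0 *; apply: filter_bigI => W D'W.
have {VF0} := VF0 W D'W.
have /set_mem[[G G_open <-]|[G G_open <-]] := D'_sub W D'W.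
- move=> F0G.
  have /(nbhs_zero_rect G_open)[U xU [d d0 UdG]] : G (x, 0).
    exact/F0G/F0P.
  exists (U, d) => //= F [g [g_bd g_0] Fg] [z y].
  rewrite Fg => gzy; rewrite -(gzy : g z = y).
  have [Uz|nUz] := pselect (U z); first exact: UdG.
  by rewrite /= g_0//; apply/F0G/F0P.
- case=> -[z y0] [/F0P -> Gz].
  have [U zU [d d0 UdG]] := nbhs_zero_rect G_open Gz.
  exists (setT, d) => /=; first by split=> //; exact: filterT.
  move=> F [g [g_bd _] Fg]; exists (z, g z); split; first by rewrite Fg.
  by apply: UdG => //; exact: nbhs_singleton.
Qed.

Lemma completely_regular_bump (R : realType) (X : topologicalType) (x : X)
    (U : set X) (d : R) :
  completely_regular_space X -> nbhs x U -> 0 < d ->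
  exists g : X -> R, [/\ continuous g, small_bump U d g & g x = d].
Proof.
move=> X_cr xU d0.
have /(@uniform_separatorP _ R)[f [f_cts f01 fx fU]] :
    uniform_separator [set x] (~` U°).
  by apply: X_cr; [exact/open_closedC/open_interior|exact].
exists (fun z => d * (1 - f z)); split.
- move=> z; apply: cvgM; first exact: cvg_cst.
  by apply: cvgB; [exact: cvg_cst|exact: f_cts].
- split=> [z|z nUz].
    have /f01 : range f (f z) by exists z.
    rewrite /= in_itv/= => /andP[fz0 fz1].
    by rewrite mulr_ge0 ?subr_ge0 ?(ltW d0)//= ger_pMr// gerBl.
  rewrite (_ : f z = 1) ?subrr ?mulr0//; apply: fU; exists z => //.
  by move=> /interior_subset.
- by rewrite (_ : f x = 0) ?subr0 ?mulr1//; apply: fx; exists x.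
Qed.

(** No neighborhood of the graph of zero in S forces the value 0 at x: it
    contains the graph of a bump peaking there. *)
Lemma vietoris_bump (R : realType) (X : topologicalType)
    (S : set (CL (X * R)%type)) (F0 : vietoris (X * R)%type)
    (N : set (CL (X * R)%type)) (x : X) :
  completely_regular_space X -> contains_graphs S ->
  CL_set F0 = fgraph_set (fun=> 0) -> nbhs F0 N ->
  exists F e, [/\ S F, N F, e != 0 & CL_set F (x, e)].
Proof.
move=> X_cr S_graphs F0E.
move=> /(vietoris_small_bumps x F0E)[[U d] /= [xU d0] UdN].
have [g [g_cts g_bump gx]] := completely_regular_bump X_cr xU d0.
have [F SF Fg] := S_graphs g g_cts.
exists F, d; split=> //; [|by rewrite gt_eqF|by rewrite Fg].
by apply: UdN; exists g.
Qed.

Lemma nbhs_subtype (Y : topologicalType) (S : set Y) (F : set_type S)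
    (N : set (set_type S)) :
  nbhs F N <-> exists2 M, nbhs (set_val F) M & set_val @^-1` M `<=` N.
Proof.
split=> [[_ [[M M_open <-] MF MN]]|[M FM MN]].
  by exists M => //; exact: open_nbhs_nbhs.
by apply: filterS MN _; exact: (@initial_continuous _ _ set_val F).
Qed.

(** * First countability forces countable compactness *)

Lemma first_countable_vietoris (R : realType) (X : topologicalType)
    (S : set (CL (X * R)%type)) :
  tychonoff_space X -> contains_graphs S ->
  first_countable (vietoris_subspace S) -> countably_compact [set: X].
Proof.
move=> [X_T2 X_cr] S_graphs.
have [F0 SF0 F0E] := S_graphs (fun=> 0) (fun=> cvg_cst _).
pose G0 : vietoris_subspace S := SigSub (mem_set SF0).
apply: (@first_countable_graphs R X (vietoris_subspace S)
  (fun F => CL_set (set_val F)) G0) => //.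
- by move=> p; rewrite set_valE F0E; split=> /esym.
- move=> W W_open G0W; apply/nbhs_subtype.
  by exists (plus_set W) => //; exact: nbhs_vietoris.
- move=> N x /nbhs_subtype[M G0M MN].
  have [F [e [SF MF e0 Fe]]] := vietoris_bump x X_cr S_graphs F0E G0M.
  by exists (SigSub (mem_set SF)), e; split=> //; exact: MN.
Qed.

Lemma first_countable_upper_vietoris (R : realType) (X : topologicalType)
    (S : set (CL (X * R)%type)) :
  tychonoff_space X -> contains_graphs S ->
  first_countable (upper_vietoris_subspace S) -> countably_compact [set: X].
Proof.
move=> [X_T2 X_cr] S_graphs.
have [F0 SF0 F0E] := S_graphs (fun=> 0) (fun=> cvg_cst _).
pose G0 : upper_vietoris_subspace S := SigSub (mem_set SF0).
apply: (@first_countable_graphs R X (upper_vietoris_subspace S)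
  (fun F => CL_set (set_val F)) G0) => //.
- by move=> p; rewrite set_valE F0E; split=> /esym.
- move=> W W_open G0W; apply/nbhs_subtype.
  by exists (plus_set W) => //; exact: nbhs_upper_vietoris.
- move=> N x /nbhs_subtype[M /upper_vietoris_nbhs[W W_open [F0W WM]] MN].
  have F0_W : nbhs (F0 : vietoris _) (plus_set W) by exact: nbhs_vietoris.
  have [F [e [SF WF e0 Fe]]] := vietoris_bump x X_cr S_graphs F0E F0_W.
  by exists (SigSub (mem_set SF)), e; split=> //; exact/MN/WM.
Qed.

Theorem theorem5p1 (R : realType) (X : topologicalType)
    (X_neq0 : [set: X] !=set0) (X_tychonoff : tychonoff_space X) :
  first_countable (upper_vietoris_subspace (minimal_cusco_maps X R)) \/
  first_countable (upper_vietoris_subspace (cusco_maps0 X R)) \/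
  first_countable (upper_vietoris_subspace (cusco_maps X R)) \/
  first_countable (vietoris_subspace (minimal_cusco_maps X R)) \/
  first_countable (vietoris_subspace (cusco_maps0 X R)) \/
  first_countable (vietoris_subspace (cusco_maps X R)) ->
  countably_compact [set: X].
Proof.
have MC_graphs : contains_graphs (minimal_cusco_maps X R).
  move=> f f_cts; have [F FE] := fgraph_CL X_neq0 f_cts.
  exists F => //; rewrite /minimal_cusco_maps /= FE.
  exact: minimal_cusco_fgraph.
have L0_graphs : contains_graphs (cusco_maps0 X R).
  move=> f /MC_graphs[F [F_cusco _] FE]; exists F => //; split=> // x _.
  by exists (f x); rewrite FE xsection_fgraph.
have L_graphs : contains_graphs (cusco_maps X R).
  by move=> f /MC_graphs[F [F_cusco _] FE]; exists F.
do ?case; first [exact: first_countable_upper_vietoris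
               | exact: first_countable_vietoris].
Qed.
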